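(* Let $Q$ be a finite acyclic quiver, $W$ a finite-dimensional representation of $Q$ over a field $\mathbb{F}$, and $\sigma\in\mathbb{Z}^{Q_0}$ a weight. Consider the set $\mathcal{A}$ of linear maps $$A(\varphi):\bigoplus_{x\in Q_0}W(x)^{\sigma_+(x)}\to\bigoplus_{x\in Q_0}W(x)^{\sigma_-(x)}$$ obtained by applying $\operatorname{Hom}(\cdot,W)$ to all morphisms $\varphi:\bigoplus_{x}P_x^{\sigma_-(x)}\to\bigoplus_xP_x^{\sigma_+(x)}$ of representations of $Q$. Given the minimal $c$-shrunk subspace $U$ of $\mathcal{A}$ (with $c$ maximal), one can construct from $U$ a subrepresentation $W'$ of $W$ such that $\sigma(\underline{\dim}\,W')$ is maximal among all subrepresentations of $W$. Furthermore, $\sigma(\underline{\dim}\,W')=c$.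
   Context: $\sigma_+(x)=\max\{0,\sigma(x)\}$, $\sigma_-(x)=-\min\{0,\sigma(x)\}$, and $\sigma(\underline{\dim}\,W')=\sum_{x\in Q_0}\sigma(x)\dim W'(x)$. $P_x$ is the indecomposable projective representation of $Q$ at $x$: $P_x(y)$ has as basis the paths from $x$ to $y$, and $\operatorname{Hom}(P_x,W)\cong W(x)$. Put $\mathbf{P_1}=\bigoplus_xP_x^{\sigma_-(x)}$, $\mathbf{P_0}=\bigoplus_xP_x^{\sigma_+(x)}$; then $\operatorname{Hom}(\mathbf{P_0},W)\cong\bigoplus_xW(x)^{\sigma_+(x)}$, $\operatorname{Hom}(\mathbf{P_1},W)\cong\bigoplus_xW(x)^{\sigma_-(x)}$, and for $\varphi:\mathbf{P_1}\to\mathbf{P_0}$ the map $A(\varphi)$ is $\psi\mapsto\psi\circ\varphi$. Equivalently, $\mathcal{A}$ is the space of all block matrices in which each block from a copy of $W(x)$ (with $\sigma(x)>0$) to a copy of $W(y)$ (with $\sigma(y)<0$) is an arbitrary linear combination of the maps $W(p)$, $p$ a path from $x$ to $y$. For a subspace $U$ of the domain write $\mathcal{A}(U)=\sum_\varphi A(\varphi)U$. Set $c=\max_U(\dim U-\dim\mathcal{A}(U))$ over all subspaces $U$ of the domain. A subspace $U$ is $c$-shrunk (for this maximal $c$) if $\dim U-\dim\mathcal{A}(U)=c$. The intersection of all $c$-shrunk subspaces is again $c$-shrunk and is called the minimal $c$-shrunk subspace. *)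

(* Defs.v *)
From HB Require Import structures.
From mathcomp Require Import all_boot all_order all_algebra.
From mathcomp Require Import boolp classical_sets.
From mathcomp Require Import zify.

Set Implicit Arguments.
Unset Strict Implicit.
Unset Printing Implicit Defensive.

Import Order.TTheory GRing.Theory Num.Theory.
Local Open Scope ring_scope.
Local Open Scope classical_set_scope.

Lemma linfunE (F : fieldType) (aT rT : vectType F) (f : aT -> rT) :
  linear f -> linfun f =1 f.
Proof.
move=> f_lin u.
exact: (lfunE (HB.pack f (GRing.isLinear.Build F aT rT *:%R f f_lin)
               : {linear aT -> rT})).
Qed.

Definition dsum (F : fieldType) (I : finType) (V : I -> vectType F) :=
  {dffun forall i, V i}.

Section DirectSum.
Import VectorInternalTheory.
Variables (F : fieldType) (I : finType) (V : I -> vectType F).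
Local Notation T := (dsum V).

HB.instance Definition _ := Choice.on T.

Definition dsum_of (f : forall i, V i) : T := finfun f.

Lemma dsumE f i : dsum_of f i = f i. Proof. exact: ffunE. Qed.

Lemma dsumP (f g : T) : (forall i, f i = g i) <-> f = g.
Proof. exact: ffunP. Qed.

Fact dsum_addA : associative (fun f g : T => dsum_of (fun i => f i + g i)).
Proof. by move=> f g h; apply/dsumP=> i; rewrite !dsumE addrA. Qed.
Fact dsum_addC : commutative (fun f g : T => dsum_of (fun i => f i + g i)).
Proof. by move=> f g; apply/dsumP=> i; rewrite !dsumE addrC. Qed.
Fact dsum_add0 : left_id (dsum_of (fun=> 0))
  (fun f g : T => dsum_of (fun i => f i + g i)).
Proof. by move=> f; apply/dsumP=> i; rewrite !dsumE add0r. Qed.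
Fact dsum_addN : left_inverse (dsum_of (fun=> 0))
  (fun f : T => dsum_of (fun i => - f i))
  (fun f g : T => dsum_of (fun i => f i + g i)).
Proof. by move=> f; apply/dsumP=> i; rewrite !dsumE addNr. Qed.

HB.instance Definition _ := GRing.isZmodule.Build T
  dsum_addA dsum_addC dsum_add0 dsum_addN.

Local Notation dscale := (fun (k : F) (f : T) => dsum_of (fun i => k *: f i)).

Fact dsum_scaleA a b f : dscale a (dscale b f) = dscale (a * b) f.
Proof. by apply/dsumP=> i; rewrite !dsumE scalerA. Qed.
Fact dsum_scale1 : left_id 1 dscale.
Proof. by move=> f; apply/dsumP=> i; rewrite !dsumE scale1r. Qed.
Fact dsum_scaleDr : right_distributive dscale +%R.
Proof. by move=> k f g; apply/dsumP=> i; rewrite !dsumE scalerDr. Qed.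
Fact dsum_scaleDl f : {morph dscale^~ f : a b / a + b}.
Proof. by move=> a b; apply/dsumP=> i; rewrite !dsumE scalerDl. Qed.

HB.instance Definition _ := GRing.Zmodule_isLmodule.Build F T
  dsum_scaleA dsum_scale1 dsum_scaleDr dsum_scaleDl.

Lemma dsum0E i : (0 : T) i = 0. Proof. exact: dsumE. Qed.
Lemma dsumDE (f g : T) i : (f + g) i = f i + g i. Proof. exact: dsumE. Qed.
Lemma dsumZE k (f : T) i : (k *: f) i = k *: f i. Proof. exact: dsumE. Qed.

Let B := {ffun {i : I & 'I_(dim (V i))} -> F^o}.
Let dsum_coord (f : T) : B := [ffun t => v2r (f (tag t)) 0 (tagged t)].

Fact dsum_vect_axiom : Vector.axiom (dim B) T.
Proof.
exists (fun f => v2r (dsum_coord f)).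
  move=> k f g; rewrite -linearP; congr v2r; apply/ffunP=> t.
  by rewrite !ffunE linearP !mxE.
exists (fun r => dsum_of (fun i => r2v
          (\row_j (r2v r : B) (Tagged (fun i => 'I_(dim (V i))) j)))) => [f|r].
  apply/dsumP=> i; rewrite dsumE v2rK -[RHS]v2rK; congr r2v.
  by apply/rowP=> j; rewrite mxE ffunE.
rewrite -[RHS]r2vK; congr v2r; apply/ffunP=> -[i j].
by rewrite ffunE dsumE r2vK mxE.
Qed.

HB.instance Definition _ := Lmodule_hasFinDim.Build F T dsum_vect_axiom.

Definition dsum_pr i : 'Hom(dsum V, V i) := linfun (fun f : dsum V => f i).

Lemma dsum_prE i (f : T) : dsum_pr i f = f i.
Proof. by rewrite linfunE // => k g h; rewrite dsumDE dsumZE. Qed.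

Definition dsum_in i (v : V i) : dsum V :=
  dsum_of (@dfwith I V (fun k => 0 : V k) i v).

Lemma dsum_in_linear i : linear (@dsum_in i).
Proof.
move=> k u v; apply/dsumP=> j; rewrite !dsumE.
by have [<-|ij] := eqVneq i j;
  rewrite ?dfwith_in // !dfwith_out // scaler0 addr0.
Qed.

Lemma sum_dsum_in (f : dsum V) : \sum_i dsum_in (f i) = f.
Proof.
apply/dsumP=> j; rewrite -dsum_prE linear_sum /= (bigD1 j) //=.
rewrite dsum_prE dsumE dfwith_in big1 ?addr0 // => i ij.
by rewrite dsum_prE dsumE dfwith_out.
Qed.

End DirectSum.

Record quiver := Quiver {
  vertex :> finType;
  arrow : finType;
  tail : arrow -> vertex;
  head : arrow -> vertex }.

(* [psnoc p a] is the path [p] followed by the arrow [a]. *)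
Inductive path (Q : quiver) (x : Q) : Q -> Type :=
| pnil : path x x
| psnoc (a : arrow Q) (p : path x (tail a)) : path x (head a).

Arguments pnil {Q x}.
Arguments psnoc {Q x} a p.

Record acyclic_quiver := AcyclicQuiver {
  acyclic_base :> quiver;
  acyclicP : forall (x : acyclic_base) (p : path x x), p = pnil }.

Section PathEnum.
Variables (Q : quiver) (x : Q).

Fixpoint arrows (y : Q) (p : path x y) : seq (arrow Q) :=
  if p is psnoc a q then a :: arrows q else [::].

Fixpoint path_of (s : seq (arrow Q)) (y : Q) : option (path x y) :=
  match s with
  | [::] => if x =P y is ReflectT e then Some (ecast z (path x z) e pnil)
            else None
  | a :: s' => if head a =P y is ReflectT e
               then omap (fun p => ecast z (path x z) e (psnoc a p))
                         (path_of s' (tail a))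
               else None
  end.

Lemma arrowsK y : pcancel (@arrows y) (path_of ^~ y).
Proof.
elim=> [|a p /= ->] /=; case: eqP => // e; by rewrite [e]eq_axiomK.
Qed.

HB.instance Definition _ y := Countable.copy (path x y) (pcan_type (@arrowsK y)).

Fixpoint visited (y : Q) (p : path x y) : seq Q :=
  if p is @psnoc _ _ a q then head a :: visited q else [:: x].

Lemma size_visited y (p : path x y) : size (visited p) = (size (arrows p)).+1.
Proof. by elim: p => //= a p ->. Qed.

Lemma visited_path y (p : path x y) z :
  z \in visited p -> exists q : path z y, True.
Proof.
elim: p => [|a p IH] /=; rewrite inE; first by move/eqP->; exists pnil.
case/predU1P=> [->|/IH[q _]]; first by exists pnil.
by exists (psnoc a q).
Qed.

End PathEnum.

Section PathFinite.
Variables (Q : acyclic_quiver) (x : Q).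

Lemma visited_uniq (y : Q) (p : path x y) : uniq (visited p).
Proof.
elim: p => [|a p IH] //=; rewrite IH andbT; apply/negP.
case/visited_path=> q _.
by have /(congr1 (fun r => size (arrows r))) := acyclicP (psnoc a q).
Qed.

Lemma size_arrows (y : Q) (p : path x y) : (size (arrows p) < #|Q|)%N.
Proof.
by rewrite -size_visited -(card_uniqP (visited_uniq p)) max_card.
Qed.

Definition path_enum (y : Q) : seq (path x y) :=
  pmap (fun t : #|Q|.-bseq (arrow Q) => path_of x t y)
       (enum {: #|Q|.-bseq (arrow Q)}).

Lemma mem_path_enum y (p : path x y) : p \in undup (path_enum y).
Proof.
rewrite mem_undup mem_pmap; apply/mapP.
exists (Bseq (ltnW (size_arrows p))); first by rewrite mem_enum.
by rewrite /= arrowsK.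
Qed.

Fact path_enumP y : Finite.axiom (undup (path_enum y)).
Proof. by move=> p; rewrite count_uniq_mem ?undup_uniq // mem_path_enum. Qed.

HB.instance Definition _ (y : Q) := isFinite.Build (path x y) (@path_enumP y).

End PathFinite.

Section Representations.
Variables (F : fieldType) (Q : quiver).

Record rep := Rep {
  rspace :> Q -> vectType F;
  rmap : forall a : arrow Q, 'Hom(rspace (tail a), rspace (head a)) }.

Record morph (V W : rep) := Morph {
  mmap :> forall x : Q, 'Hom(V x, W x);
  morphP : forall a : arrow Q,
    (mmap (head a) \o rmap V a = rmap W a \o mmap (tail a))%VF }.

Fact mcomp_subproof (V W Z : rep) (g : morph W Z) (f : morph V W) a :
  ((g (head a) \o f (head a)) \o rmap V a =
    rmap Z a \o (g (tail a) \o f (tail a)))%VF.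
Proof. by rewrite -comp_lfunA morphP !comp_lfunA morphP. Qed.

Definition mcomp V W Z (g : morph W Z) (f : morph V W) : morph V Z :=
  @Morph V Z (fun x => g x \o f x)%VF (mcomp_subproof g f).

Fixpoint along (W : rep) (x y : Q) (p : path x y) : 'Hom(W x, W y) :=
  if p is @psnoc _ _ a q then (rmap W a \o along W q)%VF else \1%VF.

Definition subrep (W : rep) (W' : forall x : Q, {vspace W x}) : Prop :=
  forall a : arrow Q, (rmap W a @: W' (tail a) <= W' (head a))%VS.

Definition rep_dsum (I : finType) (V : I -> rep) : rep :=
  @Rep (fun y => dsum (fun i => V i y))
       (fun a => linfun (fun f : dsum (fun i => V i (tail a)) =>
                   dsum_of (fun i => rmap (V i) a (f i)))).

Lemma rep_dsumE (I : finType) (V : I -> rep) a (f : rep_dsum V (tail a)) i :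
  (rmap (rep_dsum V) a f : dsum (fun i => V i (head a))) i = rmap (V i) a (f i).
Proof.
rewrite /= linfunE ?dsumE // => k g h; apply/dsumP=> j.
by rewrite !dsumE linearP.
Qed.

End Representations.

Section Projectives.
Variables (F : fieldType) (Q : acyclic_quiver).

Definition pbasis (x y : Q) (p : path x y) : {ffun path x y -> F^o} :=
  [ffun q => (q == p)%:R].

Definition proj (x : Q) : rep F Q :=
  @Rep F Q (fun y => {ffun path x y -> F^o})
       (fun a => linfun (fun f : {ffun path x (tail a) -> F^o} =>
                   \sum_p f p *: pbasis (psnoc a p))).

Lemma projE x a (f : proj x (tail a)) :
  rmap (proj x) a f =
  \sum_p (f : {ffun path x (tail a) -> F^o}) p *: pbasis (psnoc a p).
Proof.
rewrite /= linfunE // => k g h; rewrite scaler_sumr -big_split /=.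
by apply: eq_bigr => p _; rewrite !ffunE scalerDl scalerA.
Qed.

Lemma sum_pbasis x y (L : lmodType F) (v : path x y -> L) (p : path x y) :
  \sum_q pbasis p q *: v q = v p.
Proof.
rewrite (bigD1 p) //= ffunE eqxx scale1r big1 ?addr0 // => q /negPf qp.
by rewrite ffunE qp scale0r.
Qed.

Lemma pbasis_sum x y (f : {ffun path x y -> F^o}) :
  f = \sum_p f p *: pbasis p.
Proof.
apply/ffunP=> q; rewrite sum_ffunE (bigD1 q) //= !ffunE eqxx [_ *: 1]mulr1.
rewrite big1 ?addr0 // => p pq.
by rewrite !ffunE eq_sym (negPf pq) scaler0.
Qed.

Lemma proj_pbasis x a (p : path x (tail a)) :
  rmap (proj x) a (pbasis p) = pbasis (psnoc a p).
Proof. by rewrite projE sum_pbasis. Qed.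

(* Indexes a direct sum with [n x] summands attached to each vertex [x]. *)
Definition copies (n : Q -> nat) := {x : Q & 'I_(n x)}.

Definition proj_pow (n : Q -> nat) : rep F Q :=
  rep_dsum (fun i : copies n => proj (tag i)).

Definition space_pow (n : Q -> nat) (W : rep F Q) : vectType F :=
  dsum (fun i : copies n => W (tag i)).

Definition gen (n : Q -> nat) (i : copies n) : proj_pow n (tag i) :=
  dsum_in (V := fun j : copies n => proj (tag j) (tag i)) (pbasis pnil).

(* The isomorphism Hom(\bigoplus_x P_x^(n x), W) = \bigoplus_x W(x)^(n x)
   and its inverse. *)
Definition eval_gen n (W : rep F Q) (psi : morph (proj_pow n) W) :
    space_pow n W :=
  dsum_of (fun i : copies n => psi (tag i) (gen i)).

Definition extend_fun n (W : rep F Q) (w : space_pow n W) (y : Q)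
    (f : dsum (fun i : copies n => proj (tag i) y)) : W y :=
  \sum_(i : copies n) \sum_(p : path (tag i) y)
     (f i : {ffun path (tag i) y -> F^o}) p *: along W p (w i).

Lemma extend_funE n (W : rep F Q) (w : space_pow n W) y :
  linfun (extend_fun w (y := y)) =1 extend_fun w (y := y).
Proof.
apply: linfunE => k f g; rewrite /extend_fun scaler_sumr -big_split /=.
apply: eq_bigr => i _; rewrite scaler_sumr -big_split /=.
apply: eq_bigr => p _; rewrite dsumDE dsumZE.
by rewrite !ffunE scalerDl scalerA.
Qed.

Fact extend_subproof n (W : rep F Q) (w : space_pow n W) a :
  (linfun (extend_fun w (y := head a)) \o rmap (proj_pow n) a =
   rmap W a \o linfun (extend_fun w (y := tail a)))%VF.
Proof.
apply/lfunP=> f; rewrite !comp_lfunE !extend_funE /extend_fun linear_sum /=.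
apply: eq_bigr => i _; rewrite linear_sum /=.
rewrite (rep_dsumE (V := fun i : copies n => proj (tag i))) projE.
under eq_bigr => p _ do rewrite sum_ffunE scaler_suml.
rewrite exchange_big /=; apply: eq_bigr => q _.
under eq_bigr => p _ do rewrite ffunE -scalerA.
rewrite -scaler_sumr (sum_pbasis (fun p => along W p (w i))) linearZ /=.
by rewrite comp_lfunE.
Qed.

Definition extend n (W : rep F Q) (w : space_pow n W) : morph (proj_pow n) W :=
  @Morph F Q (proj_pow n) W (fun y => linfun (extend_fun w (y := y)))
         (extend_subproof w).

Lemma extendK n (W : rep F Q) (w : space_pow n W) : eval_gen (extend w) = w.
Proof.
apply/dsumP=> i; rewrite dsumE /= extend_funE /extend_fun (bigD1 i) //=.
rewrite [X in _ + X]big1 ?addr0 => [|j ji]; last first.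
  apply: big1 => p _; rewrite dsumE dfwith_out 1?eq_sym //.
  by rewrite ffunE scale0r.
rewrite dsumE dfwith_in (sum_pbasis (fun p => along W p (w i))) /=.
by rewrite id_lfunE.
Qed.

Lemma eval_genK n (W : rep F Q) (psi : morph (proj_pow n) W) y :
  extend (eval_gen psi) y = psi y.
Proof.
have psi_path (i : copies n) z (p : path (tag i) z) :
    psi z (dsum_in (V := fun j : copies n => proj (tag j) z) (pbasis p)) =
    along W p (psi (tag i) (gen i)).
  elim: p => [|a p IH] /=; first by rewrite id_lfunE.
  rewrite comp_lfunE -IH -!comp_lfunE -morphP comp_lfunE; congr (psi _ _).
  apply/dsumP=> j.
  rewrite (rep_dsumE (V := fun i : copies n => proj (tag i))) !dsumE.
  by case: dfwithP => [|k ik];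
    rewrite ?dfwith_in ?dfwith_out ?linear0 ?proj_pbasis.
apply/lfunP=> f; rewrite /= extend_funE /extend_fun.
rewrite -[in RHS](sum_dsum_in f) linear_sum; apply: eq_bigr => i _.
pose L := (psi y \o linfun
  (@dsum_in F _ (fun j : copies n => proj (tag j) y) i))%VF.
have LE u : psi y (dsum_in u) = L u.
  by rewrite /L comp_lfunE linfunE //; exact: (@dsum_in_linear F _ (fun j : copies n => proj (tag j) y)).
transitivity (L ((f : dsum (fun j : copies n => proj (tag j) y)) i)).
  rewrite [in RHS](pbasis_sum ((f : dsum _) i)) linear_sum.
  by apply: eq_bigr => p _; rewrite linearZ /= dsumE -psi_path LE.
exact/esym/LE.
Qed.

End Projectives.

Section Shrunk.
Variables (F : fieldType) (D E : vectType F) (S : set 'Hom(D, E)).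

(* [sum_image U] is the sum of the subspaces [A @: U] over all [A] in the
   possibly infinite set [S], given by its universal property; it exists by
   [sum_imageP]. *)
Definition is_sum_image (U : {vspace D}) (T : {vspace E}) : Prop :=
  forall T1 : {vspace E},
    (T <= T1)%VS <-> forall A, S A -> (A @: U <= T1)%VS.

Definition sum_image (U : {vspace D}) : {vspace E} :=
  xget 0%VS [set T | is_sum_image U T].

Lemma sum_imageP U : is_sum_image U (sum_image U).
Proof.
suff [T HT] : exists T, is_sum_image U T by exact: (xgetI 0%VS HT).
pose P (T : {vspace E}) :=
  forall T1 : {vspace E}, (forall A, S A -> (A @: U <= T1)%VS) -> (T <= T1)%VS.
have P0 : P 0%VS by move=> T1 _; apply: sub0v.
pose d k := `[< exists2 T, P T & \dim T = k >].
have d0 : exists k, d k.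
  by exists 0%N; apply/asboolP; exists 0%VS; rewrite ?dimv0.
have dub k : d k -> (k <= \dim {:E})%N.
  by case/asboolP=> T _ <-; rewrite dimvS ?subvf.
case: (ex_maxnP d0 dub) => k /asboolP[T PT dT] kmax.
exists T; move=> T2; split=> [TT2 A SA|]; last exact: PT.
apply: subv_trans TT2.
have PAT : P (A @: U + T)%VS.
  by move=> T1 H; rewrite subv_add H //= PT.
have /eqP-> : (T == A @: U + T)%VS.
  by rewrite eqEdim addvSr dT kmax //; apply/asboolP; exists (A @: U + T)%VS.
exact: addvSl.
Qed.

Definition deficit (U : {vspace D}) : int :=
  (\dim U)%:Z - (\dim (sum_image U))%:Z.

Definition max_deficit (c : int) : Prop :=
  (exists U, deficit U = c) /\ (forall U, deficit U <= c).

Definition shrunk (c : int) (U : {vspace D}) : Prop := deficit U = c.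

(* A shrunk subspace contained in all others, i.e. their intersection. *)
Definition minimal_shrunk (c : int) (U : {vspace D}) : Prop :=
  shrunk c U /\ forall V, shrunk c V -> (U <= V)%VS.

Lemma max_deficit_exists : exists c, max_deficit c.
Proof.
pose d k := `[< exists U, deficit U = k%:Z >].
have d0 : exists k, d k.
  exists 0%N; apply/asboolP; exists 0%VS; rewrite /deficit dimv0.
  suff -> : sum_image 0%VS = 0%VS by rewrite dimv0.
  apply/eqP; rewrite -subv0; apply/sum_imageP => A _.
  by rewrite limg0 subvv.
have dub k : d k -> (k <= \dim {:D})%N.
  case/asboolP=> U; rewrite /deficit; have := dimvS (subvf U); lia.
case: (ex_maxnP d0 dub) => k /asboolP[U HU] kmax.
exists k%:Z; split; first by exists U.
move=> V; case eV: (deficit V) => [n|n]; last by lia.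
by rewrite lez_nat kmax //; apply/asboolP; exists V.
Qed.

Lemma shrunk_cap c U V : max_deficit c ->
  shrunk c U -> shrunk c V -> shrunk c (U :&: V)%VS.
Proof.
case=> _ cmax; rewrite /shrunk => HU HV; apply/le_anti/andP; split=> //.
have := cmax (U + V)%VS.
have capS : (sum_image (U :&: V) <= sum_image U :&: sum_image V)%VS.
  apply/sum_imageP=> A SA; apply: subv_trans (limg_cap _ _ _) _.
  by apply: capvS; [move: U {HU} | move: V {HV}] => Z;
     apply: (iffLR (@sum_imageP Z _) (subvv _)).
have addS : (sum_image (U + V) <= sum_image U + sum_image V)%VS.
  apply/sum_imageP=> A SA; rewrite limgD; apply: addvS;
  [move: U {HU capS} | move: V {HV capS}] => Z;
     apply: (iffLR (@sum_imageP Z _) (subvv _)) => //.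
move: (dimvS capS) (dimvS addS) (dimv_sum_cap U V)
  (dimv_sum_cap (sum_image U) (sum_image V)) HU HV.
rewrite /deficit; lia.
Qed.

Lemma minimal_shrunk_exists c : max_deficit c -> exists U, minimal_shrunk c U.
Proof.
move=> cP; have [[U0 HU0] _] := cP.
pose d k := `[< exists2 U, shrunk c U & \dim U = k >].
have d0 : exists k, d k by exists (\dim U0); apply/asboolP; exists U0.
case: (ex_minnP d0) => k /asboolP[U HU dU] kmin; exists U; split=> // V HV.
have HUV := shrunk_cap cP HU HV.
have /eqP<- : (U :&: V == U)%VS.
  rewrite eqEdim capvSl dU kmin //.
  by apply/asboolP; exists (U :&: V)%VS.
exact: capvSr.
Qed.

End Shrunk.

Section Weight.
Variables (F : fieldType) (Q : acyclic_quiver).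

Definition pos_part (sigma : Q -> int) (x : Q) : nat :=
  absz (Num.max 0 (sigma x)).

Definition neg_part (sigma : Q -> int) (x : Q) : nat :=
  absz (- Num.min 0 (sigma x)).

Definition weight (W : rep F Q) (sigma : Q -> int)
    (W' : forall x : Q, {vspace W x}) : int :=
  \sum_(x : Q) sigma x * (\dim (W' x))%:Z.

Section Maps.
Variables (m n : Q -> nat) (W : rep F Q).

(* [Hom(phi, W) : psi |-> psi \o phi], read through [eval_gen]. *)
Definition hom_map_fun (phi : morph (proj_pow F m) (proj_pow F n))
    (w : space_pow n W) : space_pow m W :=
  eval_gen (mcomp (extend w) phi).

Definition hom_map (phi : morph (proj_pow F m) (proj_pow F n)) :
    'Hom(space_pow n W, space_pow m W) :=
  linfun (hom_map_fun phi).

Lemma hom_mapE phi w : hom_map phi w = hom_map_fun phi w.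
Proof.
rewrite linfunE // => k u v; apply/dsumP=> i.
rewrite dsumDE dsumZE !dsumE /= !comp_lfunE !extend_funE /extend_fun.
rewrite scaler_sumr -big_split /=; apply: eq_bigr => j _.
rewrite scaler_sumr -big_split /=; apply: eq_bigr => p _.
by rewrite dsumDE dsumZE linearP scalerDr !scalerA mulrC.
Qed.

End Maps.

Definition hom_maps (W : rep F Q) (sigma : Q -> int) :
    set 'Hom(space_pow (pos_part sigma) W, space_pow (neg_part sigma) W) :=
  [set hom_map W phi | phi in
     [set: morph (proj_pow F (neg_part sigma)) (proj_pow F (pos_part sigma))]].

(* The smallest subrepresentation [W'] of [W] such that [U] lies in
   \bigoplus_x W'(x)^(n x), see [generated_subrep], [generated_sub] and
   [generated_min]. *)
Definition generated n (W : rep F Q) (U : {vspace space_pow n W}) (y : Q) :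
    {vspace W y} :=
  (\sum_(i : copies n) \sum_(p : path (tag i) y)
     along W p @: (dsum_pr (fun j : copies n => W (tag j)) i @: U))%VS.

Definition subspace_pow n (W : rep F Q) (W' : forall x : Q, {vspace W x})
    (u : space_pow n W) : Prop :=
  forall i : copies n, (u i : W (tag i)) \in W' (tag i).

Section Generated.
Variables (n : Q -> nat) (W : rep F Q) (U : {vspace space_pow n W}).
Local Notation pr := (dsum_pr (fun j : copies n => W (tag j))).

Lemma generated_along i y (p : path (tag i) y) :
  (along W p @: (pr i @: U) <= generated U y)%VS.
Proof.
by rewrite /generated (sumv_sup i) // (sumv_sup p).
Qed.

Lemma generated_subrep : subrep (generated U).
Proof.
move=> a; rewrite {1}/generated limg_sum; apply/subv_sumP=> i _.
rewrite limg_sum; apply/subv_sumP=> p _; rewrite -limg_comp.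
exact: (generated_along (psnoc a p)).
Qed.

Lemma generated_sub u : u \in U -> subspace_pow (generated U) u.
Proof.
move=> uU i; apply: (subvP (generated_along pnil)) => /=.
by rewrite lim1g -dsum_prE memv_img.
Qed.

Lemma generated_min (W' : forall x : Q, {vspace W x}) :
    subrep W' -> (forall u, u \in U -> subspace_pow W' u) ->
  forall y, (generated U y <= W' y)%VS.
Proof.
move=> subW' UW' y; apply/subv_sumP=> i _; apply/subv_sumP=> p _.
elim: p => [|a p IH] /=.
  rewrite lim1g; apply/subvP=> _ /memv_imgP[u uU ->].
  by rewrite dsum_prE; apply: UW'.
rewrite limg_comp; exact: subv_trans (limgS _ IH) (subW' a).
Qed.

End Generated.

End Weight.

Arguments hom_maps {F Q} W sigma.

(* Main.v *)
(* Write W'^n for the subspace \bigoplus_x W'(x)^(n x) of [space_pow n W].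
   If V is a subrepresentation, every A(phi) sends V^(sigma_+) into
   V^(sigma_-), so sigma(dim V) is at most the deficit of V^(sigma_+), hence
   at most c. Conversely let W' be generated by U. Then U lies in
   W'^(sigma_+), and since u |-> in_j (W(p) u_i) is one of the maps for every
   path p, the image of U contains W'^(sigma_-); so sigma(dim W') is at least
   the deficit of U, which is c. *)

Require Import Defs.
From mathcomp Require Import all_boot all_order all_algebra.
From mathcomp Require Import zify.

Set Implicit Arguments.
Unset Strict Implicit.
Unset Printing Implicit Defensive.

Import Order.TTheory GRing.Theory Num.Theory.
Local Open Scope ring_scope.

Section DirectSumSubspace.
Variables (F : fieldType) (I : finType) (V : I -> vectType F).

Lemma dsum_in_same i (v : V i) : dsum_in v i = v.
Proof. by rewrite dsumE dfwith_in. Qed.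

Lemma dsum_in_other i j (v : V i) : i != j -> dsum_in v j = 0.
Proof. by move=> ij; rewrite dsumE dfwith_out. Qed.

(** Taking a sum of images under the injections makes this a subspace by construction; the
    coordinatewise description is [dsum_subP]. *)
Definition dsum_sub (Z : forall i, {vspace V i}) : {vspace dsum V} :=
  (\sum_i linfun (@dsum_in F I V i) @: Z i)%VS.

Lemma linfun_dsum_in i (v : V i) : linfun (@dsum_in F I V i) v = dsum_in v.
Proof. exact: linfunE (@dsum_in_linear F I V i) v. Qed.

Lemma mem_dsum_in (Z : forall i, {vspace V i}) i (v : V i) : v \in Z i -> dsum_in v \in dsum_sub Z.
Proof.
move=> Zv; apply: (subvP (sumv_sup i (erefl true) (subvv _))).
by rewrite -linfun_dsum_in memv_img.
Qed.

Lemma dsum_subP (Z : forall i, {vspace V i}) (f : dsum V) :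
  reflect (forall i, f i \in Z i) (f \in dsum_sub Z).
Proof.
apply: (iffP idP) => [/memv_sumP[g gZ ->] i|fZ]; last first.
  by rewrite -(sum_dsum_in f) memv_suml // => i _; apply: mem_dsum_in.
rewrite -dsum_prE linear_sum /= memv_suml // => j _.
have /memv_imgP[v vZ ->] := gZ j isT.
rewrite dsum_prE linfun_dsum_in; have [<-|ji] := eqVneq j i.
  by rewrite dsum_in_same.
by rewrite dsum_in_other // mem0v.
Qed.

Lemma dim_dsum_sub (Z : forall i, {vspace V i}) : \dim (dsum_sub Z) = (\sum_i \dim (Z i))%N.
Proof.
have -> : \dim (dsum_sub Z) =
    (\sum_i \dim (linfun (@dsum_in F I V i) @: Z i))%N.
  (* The sum is direct: only [g i] contributes to coordinate [i] of a vanishing sum. *)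
  apply/directvP/directv_sum_independent => g gZ g0 i _.
  apply/dsumP=> j; have [<-|ij] := eqVneq i j; last first.
    have /memv_imgP[v _ ->] := gZ i isT.
    by rewrite linfun_dsum_in dsum_in_other // dsum0E.
  rewrite -[in RHS]g0 -[RHS]dsum_prE linear_sum (bigD1 i) //= dsum_prE.
  rewrite big1 ?addr0 // => k ki.
  have /memv_imgP[v _ ->] := gZ k isT.
  by rewrite dsum_prE linfun_dsum_in dsum_in_other.
(* Each injection has trivial kernel, so images keep their dimension. *)
apply: eq_bigr => i _; apply: limg_dim_eq; apply/eqP; rewrite -subv0.
apply/subvP=> v; rewrite memv_cap memv_ker linfun_dsum_in memv0.
by case/andP=> _ /eqP v0; rewrite -(dsum_in_same v) v0 dsum0E.
Qed.

End DirectSumSubspace.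

Section PowSub.
Variables (F : fieldType) (Q : acyclic_quiver) (W : rep F Q).

Definition pow_sub (n : Q -> nat) (Z : forall x, {vspace W x}) :
    {vspace space_pow n W} :=
  dsum_sub (fun i : copies n => Z (tag i)).

Lemma dim_pow_sub n (Z : forall x, {vspace W x}) :
  \dim (pow_sub n Z) = (\sum_x n x * \dim (Z x))%N.
Proof.
rewrite dim_dsum_sub.
rewrite -(sig_big_dep (fun=> true) (fun _ _ => true)
            (fun x (_ : 'I_(n x)) => \dim (Z x))) /=.
by apply: eq_bigr => x _; rewrite sum_nat_const card_ord.
Qed.

(** Splitting $\sigma=\sigma_+-\sigma_-$ puts the weight in a form comparable with a deficit. *)
Lemma weightE (sigma : Q -> int) (Z : forall x, {vspace W x}) :
  weight sigma Z = (\dim (pow_sub (pos_part sigma) Z))%:Z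
                 - (\dim (pow_sub (neg_part sigma) Z))%:Z.
Proof.
rewrite !dim_pow_sub -!natz !natr_sum -sumrB; apply: eq_bigr => x _.
rewrite !natz !PoszM -mulrBl; congr (_ * _); rewrite /pos_part /neg_part; lia.
Qed.

Lemma along_subrep (Z : forall x, {vspace W x}) x y (p : Defs.path x y) (v : W x) :
  subrep Z -> v \in Z x -> along W p v \in Z y.
Proof.
move=> subZ vZ; elim: p => [|a p IH] /=; first by rewrite id_lfunE.
by rewrite comp_lfunE (subvP (subZ a)) // memv_img.
Qed.

(** Each coordinate of an image vector is a linear combination of vectors [along W p (u i)], and
    these stay in [Z]. *)
Lemma hom_map_pow_sub (m n : Q -> nat) (Z : forall x, {vspace W x}) phi :
  subrep Z ->
  (hom_map W phi @: pow_sub n Z <= pow_sub m Z)%VS.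
Proof.
move=> subZ; apply/subvP=> _ /memv_imgP[u /dsum_subP uZ ->].
apply/dsum_subP=> k; rewrite hom_mapE dsumE /= comp_lfunE extend_funE.
apply: memv_suml => i _; apply: memv_suml => p _.
by apply: memvZ; apply: along_subrep.
Qed.

(** Generator [j] goes to the basis vector [p] of summand [i], all other generators to 0; on summand
    [j] this is precomposition of paths with [p]. *)
Definition path_morph (m n : Q -> nat) (j : copies m) (i : copies n)
    (p : Defs.path (tag i) (tag j)) : morph (proj_pow F m) (proj_pow F n) :=
  extend (dsum_in (V := fun k : copies m => proj_pow F n (tag k)) (i := j)
    (dsum_in (V := fun k : copies n => proj F (tag k) (tag j)) (i := i)
       (pbasis F p))).

Lemma hom_map_path (m n : Q -> nat) (j : copies m) (i : copies n)
    (p : Defs.path (tag i) (tag j)) (u : space_pow n W) :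
  hom_map W (path_morph p) u =
  dsum_in (V := fun k : copies m => W (tag k)) (i := j) (along W p (u i)).
Proof.
rewrite hom_mapE; apply/dsumP=> k; rewrite dsumE /= comp_lfunE.
have -> : path_morph p (tag k) (gen F k) =
          eval_gen (path_morph p) k by rewrite dsumE.
rewrite extendK; have [<-|jk] := eqVneq j k; last first.
  by rewrite !dsum_in_other // linear0.
rewrite !dsum_in_same extend_funE /extend_fun (bigD1 i) //=.
rewrite [X in _ + X]big1 ?addr0 => [|l li].
  by rewrite dsum_in_same (sum_pbasis (fun q => along W q (u i))).
apply: big1 => q _; rewrite dsum_in_other 1?eq_sym //.
by rewrite ffunE scale0r.
Qed.

End PowSub.

Theorem theorem3p3 (F : fieldType) (Q : acyclic_quiver) (W : rep F Q)
    (sigma : Q -> int) (c : int)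
    (U : {vspace space_pow (pos_part sigma) W}) :
  max_deficit (hom_maps W sigma) c ->
  minimal_shrunk (hom_maps W sigma) c U ->
  let W' := generated U in
  [/\ subrep W',
      forall V : (forall x : Q, {vspace W x}),
        subrep V -> weight sigma V <= weight sigma W'
    & weight sigma W' = c].
Proof.
move=> [_ cmax] [Uc _] W'.
have weight_le (V : forall x, {vspace W x}) : subrep V -> weight sigma V <= c.
  (* The test subspace is $V^{\sigma_+}$, whose image lies in $V^{\sigma_-}$. *)
  move=> subV; apply: le_trans (cmax (pow_sub (pos_part sigma) V)).
  rewrite weightE /deficit lerD2l lerN2 lez_nat; apply: dimvS.
  by apply/sum_imageP => _ [phi _ <-]; apply: hom_map_pow_sub.
have subW' : subrep W' by apply: generated_subrep.
suff W'c : weight sigma W' = c by split=> // V /weight_le; rewrite W'c.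
apply/le_anti; rewrite weight_le //= -Uc weightE.
rewrite /deficit lerB // lez_nat dimvS //.
  by apply/subvP=> u uU; apply/dsum_subP=> i; apply: generated_sub.
(* Vectors $\mathrm{in}_j(W(p)u_i)$ with $u\in U$ span $W'^{\sigma_-}$; each is the value at $u$ of
   the map induced by [path_morph F p]. *)
apply/subv_sumP=> j _; rewrite limg_sum; apply/subv_sumP=> i _.
rewrite limg_sum; apply/subv_sumP=> p _.
have SA : hom_maps W sigma (hom_map W (path_morph F p))
  by exists (path_morph F p).
(* The universal property, applied to the sum itself as upper bound, shows that it contains the
   image of [U] under this map. *)
apply: subv_trans (iffLR (@sum_imageP _ _ _ _ U _) (subvv _) _ SA).
apply/subvP=> _ /memv_imgP[_ /memv_imgP[_ /memv_imgP[u uU ->] ->] ->].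
rewrite (linfun_dsum_in (V := fun k : copies _ => W (tag k))) dsum_prE.
by rewrite -hom_map_path memv_img.
Qed.
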